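(* Let $k\ge0$ be a fixed integer, $\mu_k\in\mathbb{R}\setminus\{0\}$ and $n\ge k$. Let $l$ be the number of non-common zeros between $\mathcal{P}_n(x;\mu_k)$ and $\mathcal{P}_n(x)$, and let $x^{(n)}_j(\mu)$ and $x^{(n)}_j$, $j=1,\dots,l$, denote, in increasing order, the non-common zeros of $\mathcal{P}_n(x;\mu_k)$ and of $\mathcal{P}_n(x)$, respectively. If $\mu_k<0$, then $$x^{(n)}_1(\mu)<x^{(n)}_1<x^{(n)}_2(\mu)<\cdots<x^{(n)}_{l-1}<x^{(n)}_l(\mu)<x^{(n)}_l .$$ If $\mu_k>0$, the same holds with the roles of $x^{(n)}_j(\mu)$ and $x^{(n)}_j$ interchanged, i.e. $$x^{(n)}_1<x^{(n)}_1(\mu)<x^{(n)}_2<\cdots<x^{(n)}_{l-1}(\mu)<x^{(n)}_l<x^{(n)}_l(\mu).$$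
   Context: Here $(c_n)_{n\ge0}$ and $(\lambda_n)_{n\ge0}$ are sequences of positive real numbers. The (L-orthogonal) polynomials $\mathcal{P}_n$ are defined by $\mathcal{P}_{-1}=0$, $\mathcal{P}_0=1$, $\mathcal{P}_{n+1}(x)=(x-c_n)\mathcal{P}_n(x)-\lambda_n x\,\mathcal{P}_{n-1}(x)$ for $n\ge0$. The co-recursive polynomials $\mathcal{P}_n(x;\mu_k)$ are defined by the same recurrence and initial conditions, except that at the single level $n=k$ the coefficient $c_k$ is replaced by $c_k+\mu_k$. A common zero is a point at which both $\mathcal{P}_n(\cdot)$ and $\mathcal{P}_n(\cdot;\mu_k)$ vanish; the non-common zeros of either polynomial are its zeros which are not common zeros (each of the two polynomials has $l$ of them). *)

(* Defs.v *)
From mathcomp Require Import all_boot all_order all_algebra.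
From mathcomp Require Import reals.
From mathcomp Require Export complex.

Set Implicit Arguments.
Unset Strict Implicit.
Unset Printing Implicit Defensive.

Import Order.TTheory GRing.Theory Num.Theory.
Local Open Scope ring_scope.

Section LOrthogonal.
Variable R : realType.

(* The inner [match] encodes the convention P_(-1) = 0. *)
Fixpoint Lpoly (c lambda : nat -> R) (n : nat) : {poly R} :=
  match n with
  | 0 => 1
  | m.+1 =>
      ('X - (c m)%:P) * Lpoly c lambda m
      - lambda m *: ('X * (match m with 0 => 0 | m'.+1 => Lpoly c lambda m' end))
  end.

Definition perturb (c : nat -> R) (k : nat) (mu : R) : nat -> R :=
  fun m => if m == k then c m + mu else c m.

Definition corec_Lpoly (c lambda : nat -> R) (k : nat) (mu : R) (n : nat) :
    {poly R} :=
  Lpoly (perturb c k mu) lambda n.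

Definition toC (p : {poly R}) : {poly R[i]} := map_poly (real_complex R) p.

(* All complex zeros of p (nonzero), repeated according to multiplicity. *)
Definition zeros (p : {poly R}) : seq R[i] :=
  sval (closed_field_poly_normal (toC p)).

(* The zeros of p that are not zeros of q, with their multiplicity in p. *)
Definition noncommon_zeros (p q : {poly R}) : seq R[i] :=
  [seq z <- zeros p | ~~ root (toC q) z].

(* In particular, this asserts that the non-common zeros of p are all real. *)
Definition increasing_noncommon_zeros (p q : {poly R}) (s : seq R) : Prop :=
  sorted <=%R s /\ perm_eq (map (real_complex R) s) (noncommon_zeros p q).

(* a_1 < b_1 < a_2 < b_2 < ... < a_l < b_l (0-based indices below) *)
Definition interlace (l : nat) (a b : l.-tuple R) : Prop :=
  (forall j : 'I_l, tnth a j < tnth b j) /\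
  (forall i j : 'I_l, nat_of_ord j = i.+1 -> tnth b i < tnth a j).

End LOrthogonal.

(* Main.v *)
(* Write Q for the polynomial obtained by running the recurrence from level k + 1
   with initial values 0, 1. Then the co-recursive polynomial is P_n - mu P_k Q.
   The zeros of P_n are positive and simple and P_(n-1) P_n' > 0 there, so a
   Casorati determinant shows that P_k Q P_n' >= 0 at the zeros of P_n, with
   equality exactly when P_k and Q both vanish; these are the common zeros, and
   P_k Q vanishes doubly there. Dividing out the common zeros leaves A and
   A - mu E with E A' > 0 at the zeros of A; hence A - mu E alternates in sign
   along the zeros of A together with one point far to the right (mu > 0) or far
   to the left (mu < 0), which locates all its zeros. In particular they are real,
   whatever the sign of c_k + mu. *)
Require Import Defs.
From mathcomp Require Import all_boot all_order all_algebra.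
From mathcomp Require Import reals.
From mathcomp Require Import polyrcf ring zify.

Import Order.TTheory GRing.Theory Num.Theory.

Set Implicit Arguments.
Unset Strict Implicit.
Unset Printing Implicit Defensive.

Local Open Scope ring_scope.


(** * Signs and zeros of products of linear factors *)

Lemma nth_lt_sorted (R : realFieldType) (s : seq R) (i j : nat) :
  sorted <%R s -> (i < j < size s)%N -> s`_i < s`_j.
Proof.
move=> s_sorted /andP[lt_ij lt_js].
by rewrite lt_sorted_ltn_nth ?inE // (ltn_trans lt_ij).
Qed.

Lemma sgr_horner_prod_XsubC (R : realFieldType) (s : seq R) (y : R) :
  y \notin s ->
  Num.sg (\prod_(x <- s) ('X - x%:P)).[y] = (-1) ^+ count (fun x => y < x) s.
Proof.
elim: s => [|x s IHs]; first by rewrite big_nil hornerC sgr1.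
rewrite inE negb_or big_cons => /andP[y_neqx /IHs IHy].
rewrite hornerM sgrM IHy hornerXsubC /= exprD; congr (_ * _).
by case: ltgtP y_neqx => // xy _;
  [rewrite ltr0_sg | rewrite gtr0_sg]; rewrite ?subr_lt0 ?subr_gt0.
Qed.

Lemma count_gt_sorted (R : realFieldType) (s : seq R) (y : R) (j : nat) :
    (j <= size s)%N ->
    (forall i, (i < j)%N -> s`_i <= y) ->
    (forall i, (j <= i < size s)%N -> y < s`_i) ->
  count (fun x => y < x) s = (size s - j)%N.
Proof.
move=> le_js le_y lt_y; rewrite -[in LHS](cat_take_drop j s) count_cat.
rewrite -size_drop (_ : count _ (take j s) = 0%N).
  apply/eqP; rewrite add0n -all_count; apply/(all_nthP 0) => i.
  rewrite size_drop nth_drop => lt_i; apply: lt_y.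
  by rewrite leq_addr -ltn_subRL.
apply/eqP; rewrite -leqn0 leqNgt -has_count -all_predC; apply/(all_nthP 0) => i.
rewrite size_takel // => lt_ij; rewrite nth_take //= -leNgt; exact: le_y.
Qed.

(** At a simple zero the derivative equals the product of the remaining factors, so its sign counts
    the zeros further right. *)
Lemma sgr_deriv_prod_XsubC (R : realFieldType) (s : seq R) (j : nat) :
    sorted <%R s -> (j < size s)%N ->
  Num.sg (\prod_(x <- s) ('X - x%:P))^`().[s`_j] = (-1) ^+ (size s - j.+1).
Proof.
move=> s_sorted lt_js; set z := s`_j.
have z_s : z \in s by rewrite mem_nth.
have s_perm := perm_to_rem z_s.
have z_rem : z \notin rem z s by rewrite mem_rem_uniqF // lt_sorted_uniq.
rewrite (perm_big _ s_perm) big_cons derivM derivXsubC mul1r hornerD hornerM.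
rewrite hornerXsubC subrr mul0r addr0 sgr_horner_prod_XsubC //; congr (_ ^+ _).
transitivity (count (fun x => z < x) s).
  by rewrite (permP s_perm) /= ltxx.
apply: count_gt_sorted => // i; last exact: nth_lt_sorted.
rewrite ltnS leq_eqVlt => /predU1P[-> // | lt_ij].
by rewrite ltW // nth_lt_sorted // lt_ij.
Qed.

(** The intermediate value theorem puts a zero in each of the [l] gaps of [p]; as [G] has degree
    [l], there are no others. *)
Lemma alternating_roots (R : rcfType) (G : {poly R}) (p : seq R) (l : nat) :
    G \is monic -> size G = l.+1 -> size p = l.+1 -> sorted <%R p ->
    (forall i, (i <= l)%N -> Num.sg G.[p`_i] = (-1) ^+ (l - i)) ->
  exists b : seq R, [/\ size b = l, sorted <%R b,
    G = \prod_(x <- b) ('X - x%:P)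
    & forall i, (i < l)%N -> p`_i < b`_i < p`_i.+1].
Proof.
move=> G_monic G_size p_size p_sorted G_sg.
have root_ex (i : 'I_l) : exists x : R, (p`_i < x < p`_i.+1) && root G x.
  have lt_il := ltn_ord i.
  have lt_p : p`_i < p`_i.+1 by rewrite nth_lt_sorted // p_size ltnS leqnn.
  have [|x] := @poly_ivtoo R G p`_i p`_i.+1 (ltW lt_p).
    rewrite -sgr_lt0 sgrM !G_sg //; last exact: ltnW.
    rewrite (_ : (l - i = (l - i.+1).+1)%N); last lia.
    by rewrite exprS mulN1r mulNr -expr2 sqrr_sign oppr_lt0 ltr01.
  by rewrite in_itv /= => x_in x_root; exists x; rewrite x_in.
have [f f_in] := fin_all_exists root_ex.
pose b := codom f.
have b_size : size b = l by rewrite size_codom card_ord.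
have b_nth i : (i < l)%N -> (p`_i < b`_i < p`_i.+1) && root G b`_i.
  move=> lt_il; suff -> : b`_i = f (Ordinal lt_il) by exact: (f_in (Ordinal lt_il)).
  rewrite /b codomE (nth_map (Ordinal lt_il)) ?size_enum_ord //.
  by congr f; apply: val_inj; rewrite /= nth_enum_ord.
have b_sorted : sorted <%R b.
  apply/(sortedP 0) => i; rewrite b_size => lt_i.
  have /andP[/andP[_ lt1] _] := b_nth i (ltnW lt_i).
  have /andP[/andP[lt2 _] _] := b_nth i.+1 lt_i.
  exact: lt_trans lt2.
exists b; split=> // [|i /b_nth/andP[] //].
rewrite [LHS](@all_roots_prod_XsubC _ G b) ?b_size //.
- by rewrite (monicP G_monic) scale1r.
- by apply/(all_nthP 0) => i; rewrite b_size => /b_nth/andP[].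
- by rewrite uniq_rootsE lt_sorted_uniq.
Qed.

(** Supplies the extra right-hand point for [alternating_roots]: beyond the Cauchy bound, [G] has
    the sign of its leading coefficient. *)
Lemma sorted_rcons_above (R : rcfType) (G : {poly R}) (s : seq R) :
    G \is monic -> sorted <%R s ->
  exists M, sorted <%R (rcons s M) /\ Num.sg G.[M] = 1.
Proof.
move=> G_monic s_sorted; pose M := Num.max (cauchy_bound G) (last 0 s + 1).
exists M; split.
  case: s s_sorted @M => //= x s ss; rewrite rcons_path ss /=.
  by rewrite lt_max ltrDl ltr01 orbT.
have := sgp_pinftyP (ge_cauchy_bound (monic_neq0 G_monic)).
move=> /(_ M) ->; last by rewrite in_itv /= andbT le_max lexx.
by rewrite /sgp_pinfty (monicP G_monic) sgr1.
Qed.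

Lemma sorted_cons_below (R : rcfType) (G : {poly R}) (s : seq R) :
    G \is monic -> sorted <%R s ->
  exists M, sorted <%R (M :: s) /\ Num.sg G.[M] = (-1) ^+ (size G).-1.
Proof.
move=> G_monic s_sorted; pose M := Num.min (- cauchy_bound G) (head 0 s - 1).
exists M; split.
  case: s s_sorted @M => //= x s ->; rewrite andbT.
  by rewrite gt_min gtrBl ltr01 orbT.
have := sgp_minftyP (le_cauchy_bound (monic_neq0 G_monic)).
move=> /(_ M) ->; last by rewrite in_itv /= ge_min lexx.
by rewrite /sgp_minfty (monicP G_monic) mulr1 sgrX sgrN1.
Qed.


(** * Interlacing under a perturbation of lower degree *)

Definition interlaced (R : realFieldType) (a b : seq R) : Prop :=
  (forall i, (i < size a)%N -> a`_i < b`_i) /\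
  (forall i, (i.+1 < size a)%N -> b`_i < a`_i.+1).

Lemma root_prod_XsubC_deriv (R : realFieldType) (s : seq R) (x : R) :
  sorted <%R s -> x \in s -> (\prod_(y <- s) ('X - y%:P))^`().[x] != 0.
Proof.
move=> s_sorted /(nthP 0)[j lt_js <-].
by rewrite -sgr_eq0 sgr_deriv_prod_XsubC // signr_eq0.
Qed.

Lemma monic_perturb (R : realFieldType) (a : seq R) (E : {poly R}) :
    (size E <= size a)%N ->
    let G := \prod_(x <- a) ('X - x%:P) + E in
  G \is monic /\ size G = (size a).+1.
Proof.
move=> E_size; set A := \prod_(x <- a) _.
have lt_EA : (size E < size A)%N by rewrite size_prod_XsubC ltnS.
split; first by rewrite monicE lead_coefDl // -monicE monic_prod_XsubC.
by rewrite size_polyDl // size_prod_XsubC.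
Qed.

(** At the zeros of [A] only [- (mu *: E)] is left, and there [E] has the sign of the derivative of
    [A], which alternates. *)
Lemma perturbed_roots_interlace (R : rcfType) (a : seq R) (E : {poly R})
    (mu : R) :
    let A := \prod_(x <- a) ('X - x%:P) in
    mu != 0 -> sorted <%R a -> (size E <= size a)%N ->
    (forall x, x \in a -> 0 < E.[x] * A^`().[x]) ->
  exists b : seq R, [/\ size b = size a, sorted <%R b,
    A - mu *: E = \prod_(x <- b) ('X - x%:P),
    mu < 0 -> interlaced b a & 0 < mu -> interlaced a b].
Proof.
move=> A mu_neq0 a_sorted E_size E_gt0; set G := A - _; set l := size a.
have muE_size : (size (- (mu *: E)) <= size a)%N by rewrite size_polyN size_scale.
have [G_monic G_size] := monic_perturb muE_size.
rewrite -/A -/G -/l in G_monic G_size.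
have G_sg j : (j < l)%N -> Num.sg G.[a`_j] = - Num.sg mu * (-1) ^+ (l - j.+1).
  move=> lt_jl; have aj : a`_j \in a by rewrite mem_nth.
  have A0 : A.[a`_j] = 0 by apply/eqP; rewrite -/(root _ _) root_prod_XsubC.
  rewrite hornerD hornerN hornerZ A0 add0r sgrN sgrM -mulNr; congr (_ * _).
  have := E_gt0 _ aj; rewrite -sgr_cp0 sgrM sgr_deriv_prod_XsubC // -/l.
  move/eqP/(congr1 (fun x => x * (-1) ^+ (l - j.+1))).
  by rewrite -mulrA -expr2 sqrr_sign mulr1 mul1r.
have [mu_lt0|mu_gt0|/eqP] := ltgtP mu 0; last by rewrite (negPf mu_neq0).
(* For [mu < 0] the extra point is on the left, so each zero found lies just before an entry of
   [a]. *)
- have [M [Ma_sorted M_sg]] := sorted_cons_below G_monic a_sorted.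
  have [||b [b_size b_sorted G_eq b_in]] :=
    alternating_roots (p := M :: a) G_monic G_size _ Ma_sorted; first by [].
    case=> [|i] lt_il /=; first by rewrite M_sg G_size subn0.
    by rewrite G_sg // ltr0_sg // opprK mul1r.
  exists b; split=> // _; split=> i; rewrite b_size => /b_in/andP[] //.
(* For [mu > 0] it is on the right, and each zero found lies just after an entry of [a]. *)
- have [M [aM_sorted M_sg]] := sorted_rcons_above G_monic a_sorted.
  have [||b [b_size b_sorted G_eq b_in]] :=
    alternating_roots (p := rcons a M) G_monic G_size _ aM_sorted.
  + by rewrite size_rcons.
  + move=> i; rewrite leq_eqVlt nth_rcons => /predU1P[->|lt_il].
      by rewrite ltnn eqxx subnn.
    by rewrite lt_il G_sg // gtr0_sg // -exprS subnSK.
  exists b; split=> // _; split=> i lt_i.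
    by have /andP[] := b_in i lt_i; rewrite nth_rcons lt_i.
  by have /andP[_] := b_in i (ltnW lt_i); rewrite nth_rcons lt_i.
Qed.

(* The double-root hypothesis guarantees that the common zeros stay simple in
   P - mu D, so that P and P - mu D have as many non-common zeros. *)
Lemma noncommon_roots_interlace (R : rcfType) (s : seq R) (D : {poly R})
    (mu : R) :
    let P := \prod_(x <- s) ('X - x%:P) in
    let a := [seq x <- s | ~~ root D x] in
    mu != 0 -> sorted <%R s -> (size D <= size s)%N ->
    (forall x, x \in s -> ~~ root D x -> 0 < D.[x] * P^`().[x]) ->
    (forall x, x \in s -> root D x -> root D^`() x) ->
  exists b t : seq R, [/\ P - mu *: D = \prod_(x <- t) ('X - x%:P),
    [seq x <- t | ~~ root P x] = b, size b = size a /\ sorted <%R b,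
    mu < 0 -> interlaced b a & 0 < mu -> interlaced a b].
Proof.
move=> P a mu_neq0 s_sorted D_size D_gt0 D_double.
pose d := [seq x <- s | root D x].
have s_perm : perm_eq s (d ++ a) by rewrite perm_sym; apply/permPl/perm_filterC.
pose C := \prod_(x <- d) ('X - x%:P); pose A := \prod_(x <- a) ('X - x%:P).
have P_eq : P = C * A by rewrite /P (perm_big _ s_perm) big_cat.
have [E D_eq] : exists E, D = E * C.
  apply/dvdpP/uniq_roots_dvdp; first by apply/allP => x; rewrite mem_filter => /andP[].
  by rewrite uniq_rootsE filter_uniq // lt_sorted_uniq.
have C_neq0 : C != 0 by rewrite monic_neq0 // monic_prod_XsubC.
have a_sorted : sorted <%R a by rewrite lt_sorted_filter.
have d_sorted : sorted <%R d by rewrite lt_sorted_filter.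
have E_size : (size E <= size a)%N.
  have [->|E_neq0] := eqVneq E 0; first by rewrite size_poly0.
  move: D_size; rewrite D_eq size_mul // size_prod_XsubC addnS /=.
  by rewrite (perm_size s_perm) size_cat addnC leq_add2l.
(* At [x] the zero of [C] is simple and that of [D = E * C] at least double, so [E] vanishes too. *)
have E_d x : x \in d -> E.[x] = 0.
  move=> xd; have := xd; rewrite mem_filter => /andP[Dx xs].
  have Cx : C.[x] = 0 by apply/eqP; rewrite -/(root _ _) root_prod_XsubC.
  have := D_double x xs Dx.
  rewrite /root D_eq derivM hornerD !hornerM Cx mulr0 add0r mulf_eq0.
  by rewrite (negPf (root_prod_XsubC_deriv d_sorted xd)) orbF => /eqP.
(* Where [A] vanishes, the derivative of [P] is [C] times that of [A], so the hypothesis on [D]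
   differs from the goal by the square of [C]. *)
have E_gt0 x : x \in a -> 0 < E.[x] * A^`().[x].
  move=> xa; have := xa; rewrite mem_filter => /andP[Dx xs].
  have Ax : A.[x] = 0 by apply/eqP; rewrite -/(root _ _) root_prod_XsubC.
  have := D_gt0 x xs Dx.
  rewrite P_eq D_eq derivM hornerD !hornerM Ax mulr0 add0r.
  rewrite (mulrC C.[x]) mulrACA -expr2.
  rewrite pmulr_lgt0 // exprn_even_gt0 //=; apply: contra Dx => /eqP Cx.
  by rewrite /root D_eq hornerM Cx mulr0.
have [b [b_size b_sorted G_eq int1 int2]] :=
  perturbed_roots_interlace mu_neq0 a_sorted E_size E_gt0.
(* The common zeros [d] are joined by the zeros [b] of [A - mu *: E]; order matters only within
   [b]. *)
exists b, (d ++ b); split=> //.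
  by rewrite big_cat /= -G_eq P_eq D_eq -/C -/A mulrBr -scalerAr (mulrC C E).
rewrite filter_cat (_ : filter _ d = [::]); last first.
  apply/eqP; rewrite -size_eq0 size_filter -leqn0 leqNgt -has_count -all_predC.
  apply/allP => x xd /=; rewrite negbK root_prod_XsubC.
  by move: xd; rewrite mem_filter => /andP[].
apply/all_filterP/allP => x xb; rewrite root_prod_XsubC (perm_mem s_perm) mem_cat.
have : root (A - mu *: E) x by rewrite G_eq root_prod_XsubC.
rewrite /root hornerD hornerN hornerZ negb_or => Gx.
(* A zero of [A - mu *: E] in [d], where [E] vanishes, would be a zero of [A], although [a] and [d]
   are disjoint; one in [a] would make [E] vanish. *)
apply/andP; split; apply/negP; [move=> xd | move=> xa].
  move: Gx; rewrite E_d // mulr0 subr0 -/(root _ _) root_prod_XsubC.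
  by move: xd; rewrite !mem_filter => /andP[->].
have Ax : A.[x] = 0 by apply/eqP; rewrite -/(root _ _) root_prod_XsubC.
move: Gx; rewrite Ax sub0r oppr_eq0 mulf_eq0 (negPf mu_neq0) /= => /eqP Ex.
by have := E_gt0 x xa; rewrite Ex mul0r ltxx.
Qed.

(** [zeros] is extracted from an existence statement, so unique factorization determines it only up
    to order. *)
Lemma zeros_prod_XsubC (R : realType) (s : seq R) :
  perm_eq (zeros (\prod_(x <- s) ('X - x%:P))) (map (real_complex R) s).
Proof.
apply: prod_XsubC_eq; rewrite /zeros.
case: closed_field_poly_normal => z /=.
have -> : toC (\prod_(x <- s) ('X - x%:P)) =
    \prod_(x <- map (real_complex R) s) ('X - x%:P).
  by rewrite /toC map_prod_XsubC big_map.
by rewrite (monicP (monic_prod_XsubC _ _ _)) scale1r.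
Qed.

Lemma noncommon_zeros_prod_XsubC (R : realType) (s : seq R) (q : {poly R}) :
  perm_eq (noncommon_zeros (\prod_(x <- s) ('X - x%:P)) q)
    (map (real_complex R) [seq x <- s | ~~ root q x]).
Proof.
rewrite (permPl (perm_filter _ (zeros_prod_XsubC s))) filter_map.
rewrite (@eq_filter _ _ (fun x => ~~ root q x)) // => x /=.
by rewrite /toC fmorph_root.
Qed.


(** * Recurrence and zeros of the L-orthogonal polynomials *)

Definition Lpoly_pred (R : realType) (c lambda : nat -> R) (n : nat) :=
  if n is m.+1 then Lpoly c lambda m else 0.

Lemma LpolyS (R : realType) (c lambda : nat -> R) (n : nat) :
  Lpoly c lambda n.+1 = ('X - (c n)%:P) * Lpoly c lambda n
    - lambda n *: ('X * Lpoly_pred c lambda n).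
Proof. by []. Qed.

Lemma Lpoly_monic_size (R : realType) (c lambda : nat -> R) (n : nat) :
  [/\ Lpoly c lambda n \is monic, size (Lpoly c lambda n) = n.+1
    & (size (Lpoly_pred c lambda n) <= n)%N].
Proof.
elim: n => [|n [P_monic P_size pred_size]].
  by rewrite /= monic1 size_poly1 size_poly0.
rewrite [Lpoly_pred _ _ _]/= P_size leqnn LpolyS.
set u := _ * Lpoly _ _ _; set v := - _.
have u_size : size u = n.+2.
  by rewrite size_monicM ?monicXsubC ?monic_neq0 // size_XsubC P_size.
have u_monic : u \is monic by rewrite monicMl // monicXsubC.
have lt_vu : (size v < size u)%N.
  rewrite u_size size_polyN ltnS (leq_trans (size_scale_leq _ _)) //.
  by rewrite (leq_trans (size_polyMleq _ _)) // size_polyX.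
by rewrite monicE lead_coefDl // size_polyDl // -monicE.
Qed.

(** At a zero x > 0 of P_n the recurrence leaves P_(n+1) = - lambda_n x P_(n-1), so by induction
    P_(n+1) alternates in sign along 0, the zeros of P_n and a far point. Sorting [0 :: s] records
    positivity and simplicity together. *)
Lemma Lpoly_zeros (R : realType) (c lambda : nat -> R) (n : nat) :
    (forall m, 0 < c m) -> (forall m, 0 < lambda m) ->
  exists s : seq R, [/\ size s = n, sorted <%R (0 :: s),
    Lpoly c lambda n = \prod_(x <- s) ('X - x%:P)
    & forall i, (i < n)%N ->
      Num.sg (Lpoly_pred c lambda n).[s`_i] = (-1) ^+ (n - i.+1)].
Proof.
move=> c_gt0 lambda_gt0; elim: n => [|n [s [s_size s_sorted P_eq pred_sg]]].
  by exists [::]; rewrite big_nil.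
have [G_monic G_size _] := Lpoly_monic_size c lambda n.+1.
have G_def := LpolyS c lambda n.
set G := Lpoly c lambda n.+1 in G_def G_monic G_size *.
have [M [sM_sorted M_sg]] := sorted_rcons_above G_monic s_sorted.
have gt0_s x : x \in s -> 0 < x.
  by move: s_sorted; rewrite /= lt_path_sortedE => /andP[/allP s_gt0 _] /s_gt0.
have lt_s i j : (i < j < n)%N -> s`_i < s`_j.
  by rewrite -s_size; apply: nth_lt_sorted; apply: path_sorted s_sorted.
have [||y [y_size y_sorted G_eq y_in]] :=
    alternating_roots (p := rcons (0 :: s) M) G_monic G_size _ sM_sorted.
- by rewrite size_rcons /= s_size.
- move=> i; rewrite nth_rcons /= s_size leq_eqVlt => /predU1P[->|].
    by rewrite ltnn eqxx subnn.
  move=> lt_in; rewrite lt_in G_def hornerD hornerN hornerZ !hornerM hornerX.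
  rewrite hornerXsubC; case: i lt_in => [_|i lt_in] /=.
    (* At 0 the recurrence gives - c_n P_n, and P_n has sign (-1)^n there because its zeros are
       positive. *)
    rewrite !(mul0r, mulr0) subr0 sub0r mulNr sgrN sgrM gtr0_sg // mul1r.
    rewrite subn0 exprS mulN1r P_eq sgr_horner_prod_XsubC; last first.
      by apply/negP => /gt0_s; rewrite ltxx.
    congr (- (_ ^+ _)); rewrite -s_size; apply/eqP; rewrite -all_count.
    by apply/allP => x /gt0_s.
  have s_i : s`_i \in s by rewrite mem_nth // s_size.
  have P0 : (Lpoly c lambda n).[s`_i] = 0.
    by apply/eqP; rewrite -/(root _ _) P_eq root_prod_XsubC.
  rewrite P0 mulr0 sub0r sgrN !sgrM pred_sg //.
  rewrite (gtr0_sg (lambda_gt0 n)) (gtr0_sg (gt0_s _ s_i)) !mul1r.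
  by rewrite -(subnSK lt_in) subSS exprS mulN1r.
have y_gt0 : path <%R 0 y.
  case: y y_size y_sorted y_in {G_eq} => //= x y [_] -> y_in.
  by have /andP[-> _] := y_in 0%N isT.
exists y; split=> // i lt_in; rewrite [Lpoly_pred _ _ _]/= P_eq.
(* The prepended 0 shifts indices by one: entry [i] of [y] lies between entries [i - 1] and [i] of
   [s], where these exist, so exactly [n - i] zeros of P_n exceed it. *)
have y_lt j : (j < i)%N -> (j < n)%N -> s`_j < y`_i.
  case: i lt_in => // i lt_in; rewrite ltnS => le_ji lt_jn.
  have /andP[lt_y _] := y_in i.+1 lt_in.
  apply: le_lt_trans lt_y; rewrite nth_rcons /= s_size lt_in.
  move: le_ji; rewrite leq_eqVlt => /predU1P[-> //|lt_ji].
  by rewrite ltW // lt_s // lt_ji.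
have y_gt j : (i <= j < n)%N -> y`_i < s`_j.
  move=> /andP[le_ij lt_jn]; have /andP[_ lt_y] := y_in i lt_in.
  apply: lt_le_trans lt_y _; rewrite nth_rcons /= s_size ltnS.
  rewrite (leq_ltn_trans le_ij lt_jn).
  move: le_ij; rewrite leq_eqVlt => /predU1P[-> //|lt_ij].
  by rewrite ltW // lt_s // lt_ij.
rewrite sgr_horner_prod_XsubC; last first.
  apply/negP => /(nthP 0)[j]; rewrite s_size => lt_jn sj_eq.
  have [lt_ji|le_ij] := ltnP j i.
    by have := y_lt j lt_ji lt_jn; rewrite sj_eq ltxx.
  by have := y_gt j; rewrite le_ij lt_jn sj_eq ltxx => /(_ isT).
rewrite (@count_gt_sorted _ s _ i) ?s_size //.
by move=> j lt_ji; rewrite ltW // y_lt // (leq_trans lt_ji).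
Qed.

(** * Co-recursive polynomials and the Casorati determinant *)

Lemma perturb_Lpoly_le (R : realType) (c lambda : nat -> R) (k : nat) (mu : R)
    (n : nat) :
  (n <= k)%N ->
  Lpoly (perturb c k mu) lambda n = Lpoly c lambda n /\
  Lpoly_pred (perturb c k mu) lambda n = Lpoly_pred c lambda n.
Proof.
elim: n => // n IHn lt_nk; have [P_eq pred_eq] := IHn (ltnW lt_nk).
by rewrite !LpolyS /= P_eq pred_eq /perturb ltn_eqF.
Qed.

(** Above level k all terms obey the same linear recurrence, so it is enough to compare levels k and
    k + 1, where the difference is 0 and - mu P_k. *)
Lemma corec_Lpoly_decomp (R : realType) (c lambda : nat -> R) (k : nat) (mu : R)
    (m : nat) :
  let c1 i := c (i + k.+1)%N in
  let lambda1 i := lambda (i + k.+1)%N in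
  corec_Lpoly c lambda k mu (m + k.+1) = Lpoly c lambda (m + k.+1)
    - mu *: (Lpoly c lambda k * Lpoly c1 lambda1 m).
Proof.
move=> c1 lambda1; rewrite /corec_Lpoly; set c' := perturb c k mu.
have [P_eq pred_eq] := perturb_Lpoly_le c lambda mu (leqnn k).
(* The recurrence has order two, so the induction carries two consecutive levels. *)
suff [] : Lpoly c' lambda (m + k.+1) = Lpoly c lambda (m + k.+1)
      - mu *: (Lpoly c lambda k * Lpoly c1 lambda1 m) /\
    Lpoly_pred c' lambda (m + k.+1) = Lpoly_pred c lambda (m + k.+1)
      - mu *: (Lpoly c lambda k * Lpoly_pred c1 lambda1 m) by [].
elim: m => [|m [IH1 IH2]].
  rewrite add0n !LpolyS P_eq pred_eq /= P_eq /c' /perturb eqxx.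
  by rewrite -!mul_polyC polyCD; split; ring.
have c'_eq : c' (m + k.+1)%N = c1 m.
  by rewrite /c' /perturb gtn_eqF // leq_addl.
rewrite addSn !LpolyS [Lpoly_pred _ _ _.+1]/= [X in _ /\ _ = X - _]/= IH1 IH2 c'_eq.
by rewrite /c1 /lambda1 -!mul_polyC; split; ring.
Qed.

(* At a zero x of P_n this reads P_(n-1)(x) Q_m(x) = w x^m P_k(x) with w > 0, where
   n = m + k + 1: the sign of P_k Q_m there is that of P_(n-1), and P_k and Q_m
   vanish together. *)
Lemma Lpoly_casorati (R : realType) (c lambda : nat -> R) (k m : nat) :
  let c1 i := c (i + k.+1)%N in
  let lambda1 i := lambda (i + k.+1)%N in
  Lpoly_pred c lambda (m + k.+1) * Lpoly c1 lambda1 m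
    - Lpoly c lambda (m + k.+1) * Lpoly_pred c1 lambda1 m
  = (\prod_(i < m) lambda1 i) *: ('X^m * Lpoly c lambda k).
Proof.
move=> c1 lambda1; elim: m => [|m IHm].
  by rewrite add0n big_ord0 /= mulr0 subr0 mulr1 scale1r mul1r.
(* One recurrence step in both families: the terms in X - c cancel, leaving the previous
   determinant. *)
transitivity (lambda1 m *: ('X * (Lpoly_pred c lambda (m + k.+1) * Lpoly c1 lambda1 m
    - Lpoly c lambda (m + k.+1) * Lpoly_pred c1 lambda1 m))).
  rewrite addSn !LpolyS [Lpoly_pred _ _ _.+1]/= [Lpoly_pred c1 _ _.+1]/=.
  by rewrite /c1 /lambda1 -!mul_polyC; ring.
by rewrite IHm big_ord_recr /= -!mul_polyC polyCM exprS; ring.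
Qed.

(** After multiplication by the square of P_(n-1), the Casorati identity turns P_k Q P_n' into w
    P_k^2 P_(n-1) P_n', whose sign is known. *)
Lemma corec_perturbation_sign (R : realType) (c lambda : nat -> R)
    (k m : nat) (s : seq R) :
    let c1 i := c (i + k.+1)%N in
    let lambda1 i := lambda (i + k.+1)%N in
    let n := (m + k.+1)%N in
    let D := Lpoly c lambda k * Lpoly c1 lambda1 m in
    (forall i, 0 < lambda i) -> size s = n -> sorted <%R (0 :: s) ->
    Lpoly c lambda n = \prod_(x <- s) ('X - x%:P) ->
    (forall i, (i < n)%N ->
      Num.sg (Lpoly_pred c lambda n).[s`_i] = (-1) ^+ (n - i.+1)) ->
  forall x, x \in s ->
    (~~ root D x -> 0 < D.[x] * (Lpoly c lambda n)^`().[x]) /\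
    (root D x -> root D^`() x).
Proof.
move=> c1 lambda1 n D lambda_gt0 s_size s_sorted P_eq pred_sg x xs.
set P := Lpoly c lambda n; set Pk := Lpoly c lambda k.
set Q := Lpoly c1 lambda1 m; set Pp := Lpoly_pred c lambda n.
have x_gt0 : 0 < x.
  by move: s_sorted xs; rewrite /= lt_path_sortedE => /andP[/allP s_gt0 _] /s_gt0.
have Px : P.[x] = 0 by apply/eqP; rewrite -/(root _ _) /P P_eq root_prod_XsubC.
pose w := (\prod_(i < m) lambda1 i) * x ^+ m.
have w_gt0 : 0 < w.
  by rewrite mulr_gt0 ?exprn_gt0 // prodr_gt0 // => i _; apply: lambda_gt0.
have cas : Pp.[x] * Q.[x] = w * Pk.[x].
  have := congr1 (fun p => p.[x]) (Lpoly_casorati c lambda k m).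
  rewrite hornerD hornerN hornerZ !hornerM hornerXn -/n -/P Px mul0r subr0.
  by rewrite mulrA.
have wronskian_gt0 : 0 < Pp.[x] * P^`().[x].
  have [j lt_js <-] := nthP 0 xs; rewrite -sgr_cp0 sgrM pred_sg -?s_size //.
  rewrite /P P_eq sgr_deriv_prod_XsubC ?(path_sorted s_sorted) //.
  by rewrite -expr2 sqrr_sign.
have Pp_neq0 : Pp.[x] != 0.
  by apply: contraTneq wronskian_gt0 => ->; rewrite mul0r ltxx.
have Q0 : Pk.[x] = 0 -> Q.[x] = 0.
  move=> Pk0; apply/eqP; move/eqP: cas; rewrite Pk0 mulr0 mulf_eq0.
  by rewrite (negPf Pp_neq0).
have Pk0 : Q.[x] = 0 -> Pk.[x] = 0.
  move=> Qx; apply/eqP; move/eqP: cas; rewrite Qx mulr0 eq_sym mulf_eq0.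
  by rewrite gt_eqF.
split=> Dx.
  have Pk_neq0 : Pk.[x] != 0.
    by apply: contra Dx => /eqP Pkx; rewrite /root hornerM -/Pk Pkx mul0r.
  rewrite -(pmulr_rgt0 _ (_ : 0 < Pp.[x] ^+ 2)) ?exprn_even_gt0 ?Pp_neq0 //.
  have -> : Pp.[x] ^+ 2 * (D.[x] * P^`().[x]) =
      w * Pk.[x] ^+ 2 * (Pp.[x] * P^`().[x]).
    rewrite hornerM -/Pk -/Q.
    have -> : Pp.[x] ^+ 2 * (Pk.[x] * Q.[x] * P^`().[x]) =
      (Pp.[x] * Q.[x]) * Pk.[x] * (Pp.[x] * P^`().[x]) by ring.
    by rewrite cas; ring.
  by rewrite mulr_gt0 // mulr_gt0 // exprn_even_gt0.
(* Either factor of [D] vanishing forces the other to vanish, hence the double zero. *)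
have [Pkx Qx] : Pk.[x] = 0 /\ Q.[x] = 0.
  move: Dx; rewrite /root hornerM mulf_eq0 => /orP[/eqP r0|/eqP r0].
    by split=> //; apply: Q0.
  by split=> //; apply: Pk0.
by rewrite /root derivM hornerD !hornerM -/Pk -/Q Pkx Qx mulr0 mul0r addr0.
Qed.

Lemma corec_Lpoly_perturbation (R : realType) (c lambda : nat -> R)
    (k : nat) (mu : R) (n : nat) (s : seq R) :
    (forall i, 0 < lambda i) -> (k <= n)%N ->
    size s = n -> sorted <%R (0 :: s) ->
    Lpoly c lambda n = \prod_(x <- s) ('X - x%:P) ->
    (forall i, (i < n)%N ->
      Num.sg (Lpoly_pred c lambda n).[s`_i] = (-1) ^+ (n - i.+1)) ->
  exists D, [/\ corec_Lpoly c lambda k mu n = Lpoly c lambda n - mu *: D,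
    (size D <= n)%N & forall x, x \in s ->
      (~~ root D x -> 0 < D.[x] * (Lpoly c lambda n)^`().[x]) /\
      (root D x -> root D^`() x)].
Proof.
move=> lambda_gt0 le_kn; have [lt_kn|le_nk] := ltnP k n; last first.
  (* Here n = k: the change at level k first affects P_(k+1), so the two polynomials coincide and
     every zero is common. *)
  move=> _ _ _ _; exists 0; rewrite scaler0 subr0 size_poly0.
  split=> // [|x _]; first by have [] := perturb_Lpoly_le c lambda mu le_nk.
  by rewrite root0 deriv0 root0.
rewrite -(subnK lt_kn); move: (n - k.+1)%N => m s_size s_sorted P_eq pred_sg.
pose c1 i := c (i + k.+1)%N; pose lambda1 i := lambda (i + k.+1)%N.
exists (Lpoly c lambda k * Lpoly c1 lambda1 m); split.
- exact: corec_Lpoly_decomp.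
- rewrite (leq_trans (size_polyMleq _ _)) //.
  have [_ -> _] := Lpoly_monic_size c lambda k.
  have [_ -> _] := Lpoly_monic_size c1 lambda1 m.
  by rewrite addnC.
- exact: corec_perturbation_sign.
Qed.

(** * Interlacing of the non-common zeros *)

Theorem theorem2p8 (R : realType) (c lambda : nat -> R)
    (c_gt0 : forall m, 0 < c m) (lambda_gt0 : forall m, 0 < lambda m)
    (k : nat) (mu : R) (mu_neq0 : mu <> 0) (n : nat) (le_kn : (k <= n)%N) :
  let P := Lpoly c lambda n in
  let Pmu := corec_Lpoly c lambda k mu n in
  let l := size (noncommon_zeros Pmu P) in
  exists xmu x : l.-tuple R,
    [/\ increasing_noncommon_zeros Pmu P xmu,
        increasing_noncommon_zeros P Pmu x,
        mu < 0 -> interlace xmu x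
      & 0 < mu -> interlace x xmu].
Proof.
move=> P Pmu l; have mu_neq0' : mu != 0 by apply/eqP.
have [s [s_size s_sorted P_eq pred_sg]] := Lpoly_zeros n c_gt0 lambda_gt0.
have [D [Pmu_eq D_size D_sign]] :=
  corec_Lpoly_perturbation mu lambda_gt0 le_kn s_size s_sorted P_eq pred_sg.
rewrite -/P -/Pmu in Pmu_eq.
rewrite -s_size in D_size; rewrite P_eq in D_sign.
have [b [t [Pmu_t b_eq [b_size b_sorted] int1 int2]]] :=
  noncommon_roots_interlace mu_neq0' (path_sorted s_sorted) D_size
    (fun x xs => (D_sign x xs).1) (fun x xs => (D_sign x xs).2).
rewrite -P_eq -/P -Pmu_eq in Pmu_t b_eq.
have Pmu_zeros : perm_eq (map (real_complex R) b) (noncommon_zeros Pmu P).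
  by rewrite perm_sym Pmu_t -b_eq noncommon_zeros_prod_XsubC.
set a := [seq x <- s | ~~ root D x] in b_size int1 int2.
(* Since [mu] is nonzero, a zero of [P] is shared with [Pmu] exactly when [D] vanishes there. *)
have a_eq : [seq x <- s | ~~ root Pmu x] = a.
  apply: eq_in_filter => x xs; congr (~~ _).
  have Px : P.[x] = 0 by apply/eqP; rewrite -/(root _ _) /P P_eq root_prod_XsubC.
  rewrite /root Pmu_eq hornerD hornerN hornerZ Px sub0r oppr_eq0 mulf_eq0.
  by rewrite (negPf mu_neq0').
have P_zeros : perm_eq (map (real_complex R) a) (noncommon_zeros P Pmu).
  by rewrite perm_sym [X in noncommon_zeros X _]P_eq -a_eq noncommon_zeros_prod_XsubC.
have lb : size b = l by rewrite /l -(perm_size Pmu_zeros) size_map.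
have la : size a = l by rewrite -b_size.
have le_sorted (r : seq R) : sorted <%R r -> sorted <=%R r.
  by rewrite lt_sorted_uniq_le => /andP[].
have interlaceP (u v : l.-tuple R) : interlaced u v -> interlace u v.
  move=> [lt_uv lt_vu]; split=> [j|i j ji]; rewrite !(tnth_nth 0).
    by apply: lt_uv; rewrite size_tuple.
  by rewrite ji; apply: lt_vu; rewrite size_tuple -ji.
exists (Tuple (introT eqP lb)), (Tuple (introT eqP la)); split.
- by split=> //=; apply: le_sorted.
- by split=> //=; apply/le_sorted/lt_sorted_filter/(path_sorted s_sorted).
- by move=> /int1 ab; apply: interlaceP.
- by move=> /int2 ab; apply: interlaceP.
Qed.
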